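(* Consider $n$ sensors with scalar positions $\psi\in\mathbb{R}^n$ and relative measurements $y_r=E_r^T\psi+w_r$, where $w_r$ is zero-mean with $\mathcal{E}(w_rw_r^T)=I$ and the relative measurement graph is connected with Laplacian $L=E_rE_r^T$. Suppose the positions $\psi_l$ of $N_l$ reference sensors, $1\le N_l<n$, are known a priori, let $\psi_f$ be the positions of the remaining sensors, and let $E_l$ and $E_f$ be the submatrices of $E_r$ consisting of the rows indexed by the reference sensors and by the remaining sensors, respectively, so that $y_r=E_l^T\psi_l+E_f^T\psi_f+w_r$. Then the covariance of the estimation error of the linear minimum variance unbiased estimate of $\psi_f$ is $$\Sigma_f=(E_fE_f^T)^{-1}=L_f^{-1}.$$ Consequently, the problem of choosing which $N_l$ sensors have known reference positions so as to minimize the variance $\mathrm{trace}(\Sigma_f)$ of the estimation error is equivalent to the noise-free leader selection problem: minimize $\mathrm{trace}(L_f^{-1})$ over $x\in\{0,1\}^n$ subject to $\mathbf{1}^Tx=N_l$.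
   Context: $\mathcal{E}$ denotes expectation and $\mathbf{1}$ the all-ones vector. $\mathcal{I}_r$ is the index set of $m$ pairs of distinct nodes between which relative measurements $y_{ij}=\psi_i-\psi_j+w_{ij}$ are taken; $E_r\in\mathbb{R}^{n\times m}$ has columns $e_{ij}$, $(i,j)\in\mathcal{I}_r$, where $e_{ij}\in\mathbb{R}^n$ has $1$ in position $i$, $-1$ in position $j$, and zeros elsewhere. The relative measurement graph is the undirected graph on $n$ nodes with edges $\mathcal{I}_r$. For $x\in\{0,1\}^n$, where $x_i=1$ marks sensor (node) $i$ as a reference sensor (leader), $L_f$ is the matrix obtained from $L$ by deleting all rows and columns indexed by those $i$ with $x_i=1$. The linear minimum variance unbiased estimate of $\psi_f$ is the estimate which, among estimates that are linear functions of $y_r-E_l^T\psi_l$ and unbiased for $\psi_f$, has minimum error variance. *)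

(* Defs.v *)
(* MathComp / MathComp-Analysis *)
From HB Require Import structures.
From mathcomp Require Import all_boot all_order all_algebra.
From mathcomp Require Import all_classical all_reals all_analysis.

Set Implicit Arguments.
Unset Strict Implicit.
Unset Printing Implicit Defensive.

Import Order.TTheory GRing.Theory Num.Theory.

Local Open Scope ring_scope.

Definition minimizes (disp : Order.disp_t) (V : porderType disp) (X : Type)
    (D : X -> Prop) (f : X -> V) (x : X) : Prop :=
  D x /\ forall y, D y -> (f x <= f y)%O.

Section Graph.
Variable n : nat.
Implicit Types Ir : {set 'I_n * 'I_n}.

(* Ir is the index set of the measurements; the orientation of a pair only
   fixes the sign convention of the measurement, so edges are undirected. *)
Definition edge Ir : rel 'I_n :=
  fun i j => ((i, j) \in Ir) || ((j, i) \in Ir).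

Definition graph_connected Ir : Prop := forall i j, connect (edge Ir) i j.

(* Column k is e_ij, for (i, j) the k-th pair of Ir. *)
Definition incidence (R : pzRingType) Ir : 'M[R]_(n, #|Ir|) :=
  \matrix_(i, k) ((i == (enum_val k).1)%:R - (i == (enum_val k).2)%:R).

Definition laplacian (R : pzRingType) Ir : 'M[R]_n :=
  incidence R Ir *m (incidence R Ir)^T.

(* Submatrix of the rows indexed by S, in increasing order of the index. *)
Definition rows_in (R : Type) (p : nat) (S : {set 'I_n}) (A : 'M[R]_(n, p)) :
    'M[R]_(#|S|, p) :=
  rowsub (fun a : 'I_#|S| => enum_val a) A.

Definition delete_rows_cols (R : Type) (S : {set 'I_n}) (A : 'M[R]_n) :
    'M[R]_#|~: S| :=
  mxsub (fun a : 'I_#|~: S| => enum_val a) (fun a => enum_val a) A.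

Definition leaders (x : {ffun 'I_n -> bool}) : {set 'I_n} := [set i | x i].

Definition grounded_laplacian (R : pzRingType) Ir (x : {ffun 'I_n -> bool}) :
    'M[R]_#|~: leaders x| :=
  delete_rows_cols (leaders x) (laplacian R Ir).

End Graph.

Section Estimation.
Context {d : measure_display} {T : measurableType d} {R : realType}.
Variable P : probability T R.

Definition mx_expectation (p q : nat) (X : T -> 'M[R]_(p, q)) :
    'M[\bar R]_(p, q) :=
  \matrix_(i, j) 'E_P[fun t => X t i j]%E.

Definition covariance_mx (p : nat) (X : T -> 'cV[R]_p) : 'M[\bar R]_p :=
  \matrix_(i, j) covariance P (fun t => X t i 0) (fun t => X t j 0).

Variables (n : nat) (Ir : {set 'I_n * 'I_n}).
Variable w : 'I_#|Ir| -> {RV P >-> R}.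
Variable S : {set 'I_n}. (* the reference sensors *)
Implicit Types (psi : 'cV[R]_n) (K : 'M[R]_(#|~: S|, #|Ir|)).

Definition noise (t : T) : 'cV[R]_#|Ir| := \col_k w k t.

Definition measurement psi (t : T) : 'cV[R]_#|Ir| :=
  (incidence R Ir)^T *m psi + noise t.

(* y_r - E_l^T psi_l *)
Definition reduced_measurement psi (t : T) : 'cV[R]_#|Ir| :=
  measurement psi t - (rows_in S (incidence R Ir))^T *m rows_in S psi.

(* A linear estimator of psi_f is identified with its matrix K. *)
Definition estimate K psi (t : T) : 'cV[R]_#|~: S| :=
  K *m reduced_measurement psi t.

Definition estimation_error K psi (t : T) : 'cV[R]_#|~: S| :=
  estimate K psi t - rows_in (~: S) psi.

Definition error_covariance K psi : 'M[\bar R]_#|~: S| :=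
  covariance_mx (estimation_error K psi).

Definition unbiased K : Prop := forall psi,
  mx_expectation (estimate K psi) = map_mx EFin (rows_in (~: S) psi).

(* Linear minimum variance unbiased; the error variance is the trace of the
   error covariance. *)
Definition is_lmvu K : Prop := forall psi,
  minimizes unbiased (fun K' => \tr (error_covariance K' psi)) K.

(* The default value 0 is only used if no such estimator exists. *)
Definition lmvu_estimator : 'M[R]_(#|~: S|, #|Ir|) :=
  xget 0 [set K | is_lmvu K]%classic.

(* Sigma_f *)
Definition lmvu_error_covariance psi : 'M[\bar R]_#|~: S| :=
  error_covariance lmvu_estimator psi.

End Estimation.

(* Main.v *)
Require Import Defs.
From HB Require Import structures.
From mathcomp Require Import all_boot all_order all_algebra.
From mathcomp Require Import all_classical all_reals all_analysis.
From mathcomp Require Import measurable_realfun.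

(** The reduced measurement is [E_f^T psi_f + w_r], so a linear estimator [K] is
    unbiased iff [K E_f^T = 1], and its error is then [K w_r], with covariance
    [K K^T].  Writing [K = K0 + D] with [K0 = (E_f E_f^T)^-1 E_f], one has
    [D E_f^T = 0], whence [tr (K K^T) = tr ((E_f E_f^T)^-1) + tr (D D^T)], which
    is minimal exactly when [D = 0].  The rows of [E_f] are independent because a
    vector in the kernel of [E_r^T] is constant on a connected graph, and so
    vanishes once it vanishes at one reference sensor. *)

Set Implicit Arguments.
Unset Strict Implicit.
Unset Printing Implicit Defensive.

Import Order.TTheory GRing.Theory Num.Theory.

Local Open Scope classical_set_scope.
Local Open Scope ring_scope.

(** * Expectations and covariances under affine maps *)

Section Expectation.
Context {d : measure_display} {T : measurableType d} {R : realType}.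

(** The integral is the difference of the integrals of the positive and negative parts, so it is
    finite only if both are. Integrability of the noise is thus read off from the stated values of
    its moments. *)
Lemma integrable_integral_fin_num (mu : {measure set T -> \bar R})
    (f : T -> \bar R) :
  measurable_fun [set: T] f -> (\int[mu]_t f t)%E \is a fin_num ->
  mu.-integrable [set: T] f.
Proof.
move=> mf; rewrite integralE fin_numB => /andP[fp fn].
apply/integrableP; split=> //.
rewrite [X in integral _ _ X](_ : _ = abse \o f)// fune_abse.
rewrite ge0_integralD//; last 2 first.
- exact: measurable_funepos.
- exact: measurable_funeneg.
by rewrite lte_add_pinfty// ltey_eq ?fp ?fn.
Qed.

Variable P : probability T R.

Lemma expectation_affine (I : finType) (X : I -> T -> R) (a e : I -> R)
    (c : R) :
  (forall i, measurable_fun [set: T] (X i)) ->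
  (forall i, 'E_P[X i] = (e i)%:E)%E ->
  'E_P[fun t => (\sum_i a i * X i t + c)%R]%E = (\sum_i a i * e i + c)%:E.
Proof.
move=> mX EX.
have iX i : P.-integrable [set: T] (EFin \o X i).
  apply: integrable_integral_fin_num; first exact/measurable_EFinP.
  by have := EX i; rewrite unlock => ->.
have iaX i : P.-integrable [set: T] (fun t => (a i)%:E * (X i t)%:E)%E.
  exact: (integrableZl measurableT (a i) (iX i)).
have -> : (fun t => \sum_i a i * X i t + c) =
    (fun t => \sum_i a i * X i t) \+ cst c by [].
have iS : P.-integrable [set: T] (EFin \o fun t => \sum_i a i * X i t).
  rewrite [X in integrable _ _ X](_ : _ =
    fun t => (\sum_i (a i)%:E * (X i t)%:E)%E); last first.
    by apply/funext => t /=; rewrite sumEFin.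
  exact: (integrable_sum measurableT).
rewrite expectationD; last 2 first.
- exact/Lfun1_integrable.
- exact/Lfun1_integrable/finite_measure_integrable_cst.
rewrite expectation_cst EFinD; congr (_ + _)%E.
rewrite unlock -sumEFin.
under eq_integral do rewrite -sumEFin.
rewrite integral_sum//; apply: eq_bigr => i _.
under eq_integral do rewrite EFinM.
have := EX i; rewrite unlock => EXi.
by rewrite integralZl ?EXi//; exact: iX.
Qed.

Lemma mx_expectation_affine (p q p' q' : nat) (Y : T -> 'M[R]_(p, q))
    (M : 'M[R]_(p, q)) (A : 'M[R]_(p', p)) (B : 'M[R]_(q, q'))
    (C : 'M[R]_(p', q')) :
  (forall k l, measurable_fun [set: T] (fun t => Y t k l)) ->
  mx_expectation P Y = map_mx EFin M ->
  mx_expectation P (fun t => A *m Y t *m B + C) =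
    map_mx EFin (A *m M *m B + C).
Proof.
move=> mY EY; apply/matrixP => i j.
(* Flattening the double sum over index pairs gives the single finite sum that [expectation_affine]
   handles. *)
have expand (Z : 'M[R]_(p, q)) : (A *m Z *m B + C) i j =
    \sum_(x : 'I_p * 'I_q) (A i x.1 * B x.2 j) * Z x.1 x.2 + C i j.
  rewrite !mxE; congr (_ + _).
  rewrite -(pair_bigA _ (fun k l => A i k * B l j * Z k l)) exchange_big.
  apply: eq_bigr => l _; rewrite !mxE mulr_suml.
  by apply: eq_bigr => k _; rewrite mulrAC.
rewrite [RHS]mxE expand [LHS]mxE.
under [X in expectation _ X]eq_fun do rewrite expand.
apply: (expectation_affine (X := fun x t => Y t x.1 x.2)) => // -[k l] /=.
by move/matrixP: EY => /(_ k l); rewrite !mxE.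
Qed.

(** As [X] is centred, [b] is the mean of [A X + b]. Centring leaves [A X], whose second moment is
    [A (X X^T) A^T], linear in [X X^T]. *)
Lemma covariance_mx_affine (m p : nat) (X : T -> 'cV[R]_m) (V : 'M[R]_m)
    (A : 'M[R]_(p, m)) (b : 'cV[R]_p) :
  (forall k, measurable_fun [set: T] (fun t => X t k 0)) ->
  mx_expectation P X = map_mx EFin 0 ->
  mx_expectation P (fun t => X t *m (X t)^T) = map_mx EFin V ->
  covariance_mx P (fun t => A *m X t + b) = map_mx EFin (A *m V *m A^T).
Proof.
move=> mX EX EXX; apply/matrixP => i j; rewrite [LHS]mxE [in LHS]unlock.
have mean k : 'E_P[fun t => (A *m X t + b)%R k 0%R]%E = (b k 0)%:E.
  have mX' l l' : measurable_fun [set: T] (fun t => X t l l').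
    by rewrite (ord1 l'); exact: mX.
  have := mx_expectation_affine A 1%:M b mX' EX.
  under [X in mx_expectation _ X]eq_fun do rewrite mulmx1.
  by rewrite mulmx0 mul0mx add0r => /matrixP/(_ k 0); rewrite !mxE.
rewrite !mean /=.
(* Since [X] has a single column, each entry of [X X^T] is a product of two coordinates. *)
have mXX k l : measurable_fun [set: T] (fun t => (X t *m (X t)^T) k l).
  under eq_fun do rewrite mxE big_ord1 mxE.
  exact: measurable_funM.
have := mx_expectation_affine A A^T 0 mXX EXX.
move=> /matrixP/(_ i j); rewrite !addr0 [LHS]mxE => <-.
congr ('E_P[_])%E; apply/funext => t /=.
rewrite addr0 mulmxA -mulmxA -trmx_mul [RHS]mxE big_ord1.
by rewrite [in RHS]mxE fctE/= !mxE !addrK.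
Qed.

End Expectation.

(** * Gram matrices and their traces *)

Section Gram.
Variable R : realFieldType.

Lemma mxtrace_gram (p q : nat) (A : 'M[R]_(p, q)) :
  \tr (A *m A^T) = \sum_i \sum_j A i j ^+ 2.
Proof.
by apply: eq_bigr => i _; rewrite !mxE; apply: eq_bigr => j _; rewrite !mxE.
Qed.

Lemma mxtrace_gram_ge0 (p q : nat) (A : 'M[R]_(p, q)) : 0 <= \tr (A *m A^T).
Proof.
by rewrite mxtrace_gram; do 2!apply: sumr_ge0 => ? _; exact: sqr_ge0.
Qed.

Lemma mxtrace_gram_eq0 (p q : nat) (A : 'M[R]_(p, q)) :
  \tr (A *m A^T) = 0 -> A = 0.
Proof.
rewrite mxtrace_gram => A0; apply/matrixP => i j; rewrite mxE.
have row_ge0 k : 0 <= \sum_l A k l ^+ 2.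
  by apply: sumr_ge0 => l _; exact: sqr_ge0.
have Ai0 : \sum_j A i j ^+ 2 = 0.
  exact: (psumr_eq0P (fun k _ => row_ge0 k) A0).
have /eqP : A i j ^+ 2 = 0.
  exact: (psumr_eq0P (fun l _ => sqr_ge0 (A i l)) Ai0).
by rewrite sqrf_eq0 => /eqP.
Qed.

(** If [v A A^T = 0], then [(v A) (v A)^T = 0], so [v A = 0] because its squared entries sum to
    zero. *)
Lemma gram_unitmx (p q : nat) (A : 'M[R]_(p, q)) :
  row_free A -> A *m A^T \in unitmx.
Proof.
move=> Afree; rewrite -row_free_unit; apply: inj_row_free => v vG0.
apply: (row_free_inj Afree); rewrite mul0mx.
apply: mxtrace_gram_eq0.
by rewrite trmx_mul mulmxA -(mulmxA v) vG0 mul0mx mxtrace0.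
Qed.

(** The inverse of the symmetric matrix [A A^T] is symmetric, so in [K K^T] one of the two inverses
    cancels the middle factor [A A^T]. *)
Lemma invmx_gram (p q : nat) (A : 'M[R]_(p, q)) :
  A *m A^T \in unitmx ->
  let K := invmx (A *m A^T) *m A in K *m K^T = invmx (A *m A^T).
Proof.
move=> AU /=; rewrite trmx_mul trmx_inv trmx_mul trmxK.
by rewrite mulmxA -(mulmxA _ A) mulVmx// mul1mx.
Qed.

(* The rows of [K - (A A^T)^-1 A] are orthogonal to those of [A]. *)
Lemma mxtrace_gram_right_inverse (p q : nat) (A K : 'M[R]_(p, q)) :
  A *m A^T \in unitmx -> K *m A^T = 1%:M ->
  let D := K - invmx (A *m A^T) *m A in
  \tr (K *m K^T) = \tr (invmx (A *m A^T)) + \tr (D *m D^T).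
Proof.
move=> AU KA D.
set K0 := invmx (A *m A^T) *m A in D *.
have DA : D *m A^T = 0 by rewrite mulmxBl KA -mulmxA mulVmx// subrr.
have DK0 : D *m K0^T = 0 by rewrite trmx_mul mulmxA DA mul0mx.
have K0D : K0 *m D^T = 0 by rewrite -[LHS]trmxK trmx_mul trmxK DK0 trmx0.
have -> : K = K0 + D by rewrite addrC subrK.
rewrite linearD/= mulmxDl !mulmxDr K0D DK0 addr0 add0r.
by rewrite mxtraceD (invmx_gram AU).
Qed.

End Gram.

(** * Row submatrices, the incidence matrix and connectivity *)

Section RowsIn.
Variables (R : pzRingType) (n : nat).
Implicit Type S : {set 'I_n}.

Lemma rows_in_mul (p q : nat) S (A : 'M[R]_(n, p)) (B : 'M[R]_(p, q)) :
  rows_in S (A *m B) = rows_in S A *m B.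
Proof. by rewrite /rows_in mul_rowsub_mx. Qed.

(** [rows_in S 1] selects the coordinates in [S] and its transpose extends by zero; selecting after
    extending changes nothing. *)
Lemma rows_in_one_gram S :
  rows_in S 1%:M *m (rows_in S 1%:M)^T = 1%:M :> 'M[R]_#|S|.
Proof.
apply/matrixP => a b; rewrite mul_rowsub_mx mul1mx !mxE eq_sym.
by rewrite (inj_eq enum_val_inj).
Qed.

Lemma trmx_mul_rows_in (p q : nat) S (A : 'M[R]_(n, p)) (B : 'M[R]_(n, q)) :
  A^T *m B = (rows_in S A)^T *m rows_in S B
             + (rows_in (~: S) A)^T *m rows_in (~: S) B.
Proof.
apply/matrixP => i j; rewrite !mxE (bigID (mem S))/=; congr (_ + _).
  by rewrite big_enum_val; apply: eq_bigr => a _; rewrite !mxE.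
rewrite (eq_bigl (mem (~: S))) => [|k]; last by rewrite /= !inE.
by rewrite big_enum_val; apply: eq_bigr => a _; rewrite !mxE.
Qed.

Lemma delete_rows_cols_laplacian Ir S :
  delete_rows_cols S (laplacian R Ir) =
  rows_in (~: S) (incidence R Ir) *m (rows_in (~: S) (incidence R Ir))^T.
Proof. by rewrite /rows_in trmx_mxsub -mxsub_mul. Qed.

Lemma incidence_kernel Ir (u : 'rV[R]_n) :
  graph_connected Ir -> u *m incidence R Ir = 0 -> forall i j, u 0 i = u 0 j.
Proof.
move=> Irc uE i j.
have sumE k : \sum_l u 0 l * (l == k)%:R = u 0 k.
  rewrite (bigD1 k)//= eqxx mulr1 big1 ?addr0// => l /negPf ->.
  by rewrite mulr0.
have pairE k l : (k, l) \in Ir -> u 0 k = u 0 l.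
  (* The entry of [u E_r] at the column of the pair [(k, l)] is [u_k - u_l]. *)
  move=> kl; move/matrixP: uE => /(_ 0 (enum_rank_in kl (k, l))).
  rewrite !mxE; under eq_bigr do rewrite mxE enum_rankK_in// mulrBr.
  by rewrite sumrB !sumE => /subr0_eq.
have edgeE k l : edge Ir k l -> u 0 k = u 0 l.
  by case/orP => [/pairE|/pairE ->].
have /connectP[p] := Irc i j.
elim: p i => [i _ -> //|k p IHp i /= /andP[/edgeE -> ] ].
exact: IHp.
Qed.

End RowsIn.

Lemma rows_in_incidence_row_free (R : fieldType) (n : nat)
    (Ir : {set 'I_n * 'I_n}) (S : {set 'I_n}) :
  graph_connected Ir -> S != finset.set0 ->
  row_free (rows_in (~: S) (incidence R Ir)).
Proof.
move=> Irc /set0Pn[s sS]; apply: inj_row_free => v vE.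
(* [u] extends [v] by zero on [S]. *)
set u := v *m rows_in (~: S) 1%:M.
have us : u 0 s = 0.
  rewrite mxE big1// => a _; rewrite !mxE.
  case: eqP => [as_|_]; last by rewrite mulr0.
  by have := enum_valP a; rewrite as_ inE sS.
have u0 : u = 0.
  (* Here [u E_r = v E_f = 0], so [u] is constant, with value [u 0 s = 0]. *)
  apply/rowP => i; rewrite [RHS]mxE -us; apply: (incidence_kernel Irc).
  by rewrite -mulmxA -rows_in_mul mul1mx.
by rewrite -[v]mulmx1 -(rows_in_one_gram R (~: S)) mulmxA -/u u0 mul0mx.
Qed.

(** * Unbiased linear estimators and the optimal one *)

Section Estimation.
Context {d : measure_display} {T : measurableType d} {R : realType}.
Variables (P : probability T R) (n : nat) (Ir : {set 'I_n * 'I_n}).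
Variables (w : 'I_#|Ir| -> {RV P >-> R}) (S : {set 'I_n}).
Let E_f := rows_in (~: S) (incidence R Ir).
Implicit Type K : 'M[R]_(#|~: S|, #|Ir|).

Lemma measurement_split psi t :
  measurement w psi t =
    (rows_in S (incidence R Ir))^T *m rows_in S psi
    + E_f^T *m rows_in (~: S) psi + noise w t.
Proof. by rewrite /measurement (trmx_mul_rows_in S). Qed.

Lemma estimateE K psi t :
  estimate w K psi t = K *m noise w t + K *m E_f^T *m rows_in (~: S) psi.
Proof.
rewrite /estimate /reduced_measurement measurement_split.
by rewrite addrC addrA addKr mulmxDr mulmxA addrC.
Qed.

Lemma measurable_noise k : measurable_fun [set: T] (fun t => noise w t k 0).
Proof. by under eq_fun do rewrite mxE; exact: measurable_funPT. Qed.

Hypothesis w_mean : mx_expectation P (noise w) = map_mx EFin 0.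

Lemma mx_expectation_estimate K psi :
  mx_expectation P (estimate w K psi) =
    map_mx EFin (K *m E_f^T *m rows_in (~: S) psi).
Proof.
have -> : estimate w K psi =
    fun t => K *m noise w t *m 1%:M + K *m E_f^T *m rows_in (~: S) psi.
  by apply/funext => t; rewrite mulmx1 estimateE.
rewrite (mx_expectation_affine _ _ _ _ w_mean); last first.
  by move=> k l; rewrite (ord1 l); exact: measurable_noise.
by rewrite mulmx0 mul0mx add0r.
Qed.

Lemma unbiasedE K : unbiased w K <-> K *m E_f^T = 1%:M.
Proof.
split=> [Ku|KE psi]; last by rewrite mx_expectation_estimate KE mul1mx.
apply/matrixP => i j.
have : map_mx EFin (K *m E_f^T *m delta_mx j 0) =
    map_mx EFin (delta_mx j (0 : 'I_1)).
  (* Test unbiasedness on the extension by zero of the [j]-th basis vector: this reads off column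
     [j] of [K E_f^T]. *)
  have := Ku ((rows_in (~: S) 1%:M)^T *m delta_mx j 0).
  rewrite mx_expectation_estimate rows_in_mul -[(rows_in _ 1%:M)^T]mul1mx.
  by rewrite rows_in_mul rows_in_one_gram mul1mx.
by move=> /matrixP/(_ i 0); rewrite -colE !mxE eqxx andbT => -[].
Qed.

Hypothesis w_cov : mx_expectation P (fun t => noise w t *m (noise w t)^T)
  = map_mx EFin 1%:M.

(** By [K E_f^T = 1] the true positions cancel from the error, so its covariance does not depend on
    [psi]. *)
Lemma error_covariance_unbiased K psi :
  unbiased w K -> error_covariance w K psi = map_mx EFin (K *m K^T).
Proof.
move=> /unbiasedE KE; rewrite /error_covariance.
have -> : estimation_error w K psi = fun t => K *m noise w t + 0.
  apply/funext => t.
  by rewrite /estimation_error estimateE KE mul1mx addrK addr0.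
rewrite (covariance_mx_affine _ _ measurable_noise w_mean w_cov).
by rewrite mulmx1.
Qed.

Lemma mxtrace_EFin (p : nat) (M : 'M[R]_p) :
  \tr (map_mx EFin M) = (\tr M)%:E.
Proof. by rewrite /mxtrace -sumEFin; apply: eq_bigr => i _; rewrite mxE. Qed.

Hypothesis E_f_gram_unit : E_f *m E_f^T \in unitmx.
(** The Moore-Penrose inverse of [E_f^T], that is, the least-squares estimator. *)
Let K0 := invmx (E_f *m E_f^T) *m E_f.

Lemma unbiased_gram_inverse : unbiased w K0.
Proof. by apply/unbiasedE; rewrite -mulmxA mulVmx. Qed.

Lemma is_lmvuE K : is_lmvu w K <-> K = K0.
Proof.
have K0u := unbiased_gram_inverse.
have traceE K' psi : unbiased w K' -> \tr (error_covariance w K' psi) =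
    (\tr (invmx (E_f *m E_f^T)) + \tr ((K' - K0) *m (K' - K0)^T))%:E.
  move=> K'u; rewrite error_covariance_unbiased// mxtrace_EFin.
  by rewrite (mxtrace_gram_right_inverse E_f_gram_unit)//; exact/unbiasedE.
(* The traces are independent of [psi], so [psi = 0] suffices. Comparing [K] with [K0] there bounds
   the excess [tr (D D^T)], with [D = K - K0], by zero. *)
split=> [/(_ 0)[Ku /(_ _ K0u)]|-> psi].
  rewrite !traceE// subrr mul0mx mxtrace0 lee_fin lerD2l => D_le0.
  apply/eqP; rewrite -subr_eq0; apply/eqP/mxtrace_gram_eq0/le_anti.
  by rewrite D_le0 mxtrace_gram_ge0.
split=> // K' K'u; rewrite !traceE// subrr mul0mx mxtrace0 lee_fin lerD2l.
exact: mxtrace_gram_ge0.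
Qed.

Lemma lmvu_error_covarianceE psi :
  lmvu_error_covariance w S psi = map_mx EFin (invmx (E_f *m E_f^T)).
Proof.
rewrite /lmvu_error_covariance.
have -> : lmvu_estimator w S = K0.
  (* Existence and uniqueness of the optimal estimator make the choice return [K0], not the
     default. *)
  by apply: xget_unique => [|K]; [exact/is_lmvuE|move/is_lmvuE].
rewrite error_covariance_unbiased ?invmx_gram//.
exact: unbiased_gram_inverse.
Qed.

End Estimation.

(** * Leader selection: sets of reference sensors against 0-1 vectors *)

Lemma card_leaders (n : nat) (x : {ffun 'I_n -> bool}) :
  #|leaders x| = (\sum_i x i)%N.
Proof.
rewrite -sum1_card big_mkcond; apply: eq_bigr => i _.
by rewrite inE; case: (x i).
Qed.

Lemma leaders_finfun (n : nat) (S : {set 'I_n}) :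
  leaders [ffun i => i \in S] = S.
Proof. by apply/setP => i; rewrite inE ffunE. Qed.

Theorem mainTheorem4 (R : realType) (d : measure_display)
    (T : measurableType d) (P : probability T R)
    (n : nat) (Ir : {set 'I_n * 'I_n}) (w : 'I_#|Ir| -> {RV P >-> R})
    (Nl : nat) (psi : 'cV[R]_n)
    (Ir_distinct : forall i j, (i, j) \in Ir -> i != j)
    (Ir_connected : graph_connected Ir)
    (w_mean : mx_expectation P (noise w) = map_mx EFin 0)
    (w_cov : mx_expectation P (fun t => noise w t *m (noise w t)^T)
             = map_mx EFin 1%:M)
    (Nl_bounds : (1 <= Nl < n)%N) :
  (forall S : {set 'I_n}, #|S| = Nl ->
     let E_l := rows_in S (incidence R Ir) in
     let E_f := rows_in (~: S) (incidence R Ir) in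
     let L_f := delete_rows_cols S (laplacian R Ir) in
     [/\ forall t, measurement w psi t
           = E_l^T *m rows_in S psi + E_f^T *m rows_in (~: S) psi + noise w t,
         exists! K, is_lmvu w (S := S) K,
         (E_f *m E_f^T \in unitmx) /\ (L_f \in unitmx),
         lmvu_error_covariance w S psi = map_mx EFin (invmx (E_f *m E_f^T))
       & invmx (E_f *m E_f^T) = invmx L_f])
  /\
  (forall x : {ffun 'I_n -> bool}, (\sum_i x i)%N = Nl ->
     \tr (lmvu_error_covariance w (leaders x) psi)
     = (\tr (invmx (grounded_laplacian R Ir x)))%:E)
  /\
  (forall x : {ffun 'I_n -> bool},
     minimizes (fun S : {set 'I_n} => #|S| = Nl)
       (fun S => \tr (lmvu_error_covariance w S psi)) (leaders x)
     <->
     minimizes (fun y : {ffun 'I_n -> bool} => (\sum_i y i)%N = Nl)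
       (fun y => \tr (invmx (grounded_laplacian R Ir y))) x).
Proof.
have gram_unit (S : {set 'I_n}) : #|S| = Nl ->
    let E_f := rows_in (~: S) (incidence R Ir) in E_f *m E_f^T \in unitmx.
  move=> cardS; apply/gram_unitmx/rows_in_incidence_row_free => //.
  (* The lower bound on [Nl] supplies a reference sensor at which to ground the graph. *)
  by rewrite -card_gt0 cardS; case/andP: Nl_bounds.
(* On the feasible vectors the two objectives agree up to the embedding of the reals in the extended
   reals, which preserves and reflects order. *)
have trE (x : {ffun 'I_n -> bool}) : (\sum_i x i)%N = Nl ->
    \tr (lmvu_error_covariance w (leaders x) psi) =
    (\tr (invmx (grounded_laplacian R Ir x)))%:E.
  move=> xNl; rewrite lmvu_error_covarianceE//; last first.
    by apply: gram_unit; rewrite card_leaders.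
  by rewrite mxtrace_EFin /grounded_laplacian delete_rows_cols_laplacian.
split=> [S cardS E_l E_f L_f|].
  have E_fU := gram_unit S cardS.
  have L_fE : L_f = E_f *m E_f^T := delete_rows_cols_laplacian R Ir S.
  split.
  - exact: measurement_split.
  - exists (invmx (E_f *m E_f^T) *m E_f); split; first exact/is_lmvuE.
    by move=> K /is_lmvuE ->.
  - by rewrite L_fE.
  - exact: lmvu_error_covarianceE.
  - by rewrite L_fE.
split=> // x; split=> -[].
  rewrite card_leaders => xNl xmin; split=> // y yNl.
  by rewrite -lee_fin -!trE// xmin// card_leaders.
move=> xNl xmin; split=> [|S cardS]; first by rewrite card_leaders.
(* Every competing set comes from its indicator vector, so minimality over vectors covers all sets
   of size [Nl]. *)
rewrite -(leaders_finfun S) in cardS *; rewrite card_leaders in cardS.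
by rewrite !trE// lee_fin xmin.
Qed.
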